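(* Let $E$ be a Hausdorff topological vector space, let $F\subset E^*$ be a linear subspace and let $\varphi:\mathbb{R}\to\mathbb{R}$ be continuous. Then $\operatorname{span}\{\varphi\circ(f+r\mathbf{1}) : f\in F,\ r\in\mathbb{R}\}$ is dense in $\mathcal{C}(E)$ if and only if $F$ separates the points of $E$ and $\varphi$ is not a polynomial.
   Context: All vector spaces are real and topological vector space $E$ is assumed non-trivial (not $\{0\}$). $E^*$ is the topological dual of $E$. $\mathbf{1}$ is the constant one function on $E$. $\mathcal{C}(E)$ is the space of continuous real-valued functions on $E$ with the compact-open topology (uniform convergence on compact sets). *)

(* Defs.v *)
From HB Require Import structures.
From mathcomp Require Import all_boot all_order all_algebra.
From mathcomp Require Import all_classical all_reals all_analysis.

Set Implicit Arguments.
Unset Strict Implicit.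
Unset Printing Implicit Defensive.

Import Order.TTheory GRing.Theory Num.Theory.
Import numFieldNormedType.Exports.
(* [continuousType U V] carries the compact-open topology. *)
Export ArrowAsCompactOpen.

Local Open Scope classical_set_scope.
Local Open Scope ring_scope.

(* [tvsType] is restricted to locally convex spaces, so general topological
   vector spaces are [topologicalLmodType]s. *)
Definition topological_dual (R : realType) (E : topologicalLmodType R)
  : set (E -> R) := [set f : E -> R | scalar f /\ continuous f].
Arguments topological_dual {R} E.

Definition linear_subspace (R : realType) (V : lmodType R) (A : set V) : Prop :=
  submod_closed [pred v | v \in A].

Definition linear_span (R : realType) (V : lmodType R) (A : set V) : set V :=
  [set v | exists (n : nat) (c : 'I_n -> R) (a : 'I_n -> V),
     (forall i, A (a i)) /\ v = \sum_(i < n) c i *: a i].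

Definition separates_points (T U : Type) (F : set (T -> U)) : Prop :=
  forall x y : T, x <> y -> exists2 f, F f & f x <> f y.

Definition is_polynomial (R : realType) (phi : R -> R) : Prop :=
  exists p : {poly R}, forall t, phi t = p.[t].

(* When [phi] and the members of [F] are continuous, so is every element of the
   span of this set: the span taken in [E -> R] is the span taken in C(E). *)
Definition ridge_functions (R : realType) (E : topologicalLmodType R)
    (F : set (E -> R)) (phi : R -> R) : set (E -> R) :=
  [set g | exists f (r : R), F f /\ g = phi \o (f + r *: cst 1)].

(* Main.v *)
(* Sufficiency. Let V be the set of v : R -> R such that v (f + r) lies in the
   closure of the span for all f in F and r; it is a closed, affinely invariant
   linear space containing phi. If g is continuous and lies in V then so does
   the h-difference of a primitive of g (a limit of Riemann sums), so V contains
   the k-th h-difference g of the k-th primitive of phi, a C^k function with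
   g^(k) = Delta_h^k phi. Differentiating g (a t + b) k times in a at a = 0 puts
   t^k Delta_h^k phi (b) in V. As phi is not a polynomial, Frechet's functional
   equation fails for every k, so V contains all monomials, hence the exponential.
   The functions exp f, f in F, span a point-separating algebra, to which the
   Stone-Weierstrass theorem applies.

   Necessity. A Hausdorff topological vector space is uniformizable, hence
   functionally Hausdorff, so F must separate points; if phi is a polynomial of
   degree m, the span is annihilated by the (m+1)-st differences along lines. *)
From HB Require Import structures.
Require Import Defs.
From mathcomp Require Import all_boot all_order all_algebra.
From mathcomp Require Import all_classical all_reals all_analysis.
From mathcomp Require Import ring lra.

Set Implicit Arguments.
Unset Strict Implicit.
Unset Printing Implicit Defensive.

Import Order.TTheory GRing.Theory Num.Theory.
Import numFieldNormedType.Exports.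
Local Open Scope classical_set_scope.
Local Open Scope ring_scope.

(** * Closure on compact sets and the compact-open topology *)

Definition lin_closed {R : realType} {V : lmodType R} (S : set V) : Prop :=
  S 0 /\ forall (a : R) u v, S u -> S v -> S (a *: u + v).

Section LinClosed.
Context {R : realType} {V : lmodType R}.
Implicit Types (S : set V).

Lemma linear_subspaceP S : linear_subspace S <-> lin_closed S.
Proof.
rewrite /linear_subspace /submod_closed /=; split=> -[S0 SS].
  split; first by move: S0; rewrite !inE.
  move=> a u v Su Sv; have := SS a u v; rewrite !inE; exact.
split; first by rewrite !inE.
by move=> a u v; rewrite !inE; exact: SS.
Qed.

Lemma lin_closedZ {S} (a : R) u : lin_closed S -> S u -> S (a *: u).
Proof. by case=> S0 SS Su; rewrite -[_ *: _]addr0; exact: SS. Qed.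

Lemma lin_closedD {S} u v : lin_closed S -> S u -> S v -> S (u + v).
Proof. by case=> _ SS Su Sv; rewrite -[u]scale1r; exact: SS. Qed.

Lemma lin_closedB {S} u v : lin_closed S -> S u -> S v -> S (u - v).
Proof. by case=> _ SS Su Sv; rewrite addrC -scaleN1r; exact: SS. Qed.

Lemma lin_closed_sum {S} (I : Type) (r : seq I) (f : I -> V) :
  lin_closed S -> (forall i, S (f i)) -> S (\sum_(i <- r) f i).
Proof.
by move=> linS Sf; elim/big_ind: _ => //; [exact: linS.1|move=> *; exact: lin_closedD].
Qed.

Lemma sub_linear_span S : S `<=` linear_span S.
Proof.
move=> v Sv; exists 1%N, (fun=> 1), (fun=> v); split=> //.
by rewrite big_ord1 scale1r.
Qed.

Lemma linear_span_lin_closed S : lin_closed (linear_span S).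
Proof.
split; first by exists 0%N, (fun=> 0), (fun=> 0); split=> [[]|] //; rewrite big_ord0.
move=> a _ _ [m [c [f [Sf ->]]]] [n [d [g [Sg ->]]]].
exists (m + n)%N,
  (fun i : 'I_(m + n) => match fintype.split i with inl j => a * c j | inr j => d j end),
  (fun i : 'I_(m + n) => match fintype.split i with inl j => f j | inr j => g j end).
split; first by move=> i; case: fintype.split.
rewrite big_split_ord/= scaler_sumr; congr (_ + _); apply: eq_bigr => i _.
  by rewrite (unsplitK (inl i)) scalerA.
by rewrite (unsplitK (inr i)).
Qed.

Lemma linear_span_min S S' : lin_closed S' -> S `<=` S' -> linear_span S `<=` S'.
Proof.
move=> linS' SS' _ [m [c [f [Sf ->]]]].
by apply: lin_closed_sum => // i; apply: lin_closedZ => //; exact: SS'.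
Qed.

End LinClosed.

(** The closure for uniform convergence on compact sets, taken among all functions [T -> R], so that
    bundled continuous maps appear only in [dense_approxP] and the final theorem. *)
Definition compact_approx {R : realType} {T : topologicalType} (S : set (T -> R))
    : set (T -> R) :=
  [set g | forall (K : set T) (e : R), compact K -> 0 < e ->
     exists2 s, S s & forall x, K x -> `|g x - s x| < e].

Section Approx.
Context {R : realType} {T : topologicalType}.
Implicit Types (S : set (T -> R)).

Lemma sub_approx S : S `<=` compact_approx S.
Proof. by move=> g Sg K e _ e0; exists g => // x _; rewrite subrr normr0. Qed.

Lemma approxS {S S'} : S `<=` compact_approx S' ->
  compact_approx S `<=` compact_approx S'.
Proof.
move=> SS' g Sg K e cK e0; have e2 : 0 < e / 2 by rewrite divr_gt0.
have [s Ss gs] := Sg K _ cK e2; have [t St st] := SS' _ Ss K _ cK e2.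
exists t => // x Kx; rewrite (splitr e) -(subrKA (s x)).
by rewrite (le_lt_trans (ler_normD _ _))// ltrD ?gs ?st.
Qed.

Lemma approx_idem S : compact_approx (compact_approx S) `<=` compact_approx S.
Proof. exact: approxS. Qed.

Lemma approx_lin_closed S : lin_closed S -> lin_closed (compact_approx S).
Proof.
move=> linS; split; first exact/sub_approx/linS.1.
move=> a u v Su Sv K e cK e0.
have a1 : 0 < `|a| + 1 by rewrite ltr_wpDl.
have [s Ss us] := Su K (e / 2 / (`|a| + 1)) cK (divr_gt0 (divr_gt0 e0 (ltr0n _ 2)) a1).
have [t St vt] := Sv K _ cK (divr_gt0 e0 (ltr0n _ 2)).
exists (a *: s + t); first exact: linS.2.
move=> x Kx; rewrite /= !fctE.
have -> : a *: u x + v x - (a *: s x + t x) = a * (u x - s x) + (v x - t x).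
  by rewrite /GRing.scale/=; ring.
rewrite (splitr e) (le_lt_trans (ler_normD _ _))// ltr_leD ?(ltW (vt _ Kx))//.
rewrite normrM; have [->|a0] := eqVneq a 0; first by rewrite normr0 mul0r divr_gt0.
have aa : 0 < `|a| by rewrite normr_gt0.
rewrite (@lt_trans _ _ (`|a| * (e / 2 / (`|a| + 1))))// ?ltr_pM2l ?us//.
by rewrite mulrCA gtr_pMr ?divr_gt0// ltr_pdivrMr// mul1r ltrDl.
Qed.

End Approx.

Lemma approx_comp {R : realType} {T U : topologicalType} {S : set (T -> R)}
    {S' : set (U -> R)} (h : U -> T) (g : T -> R) :
  continuous h -> (forall s, S s -> compact_approx S' (s \o h)) ->
  compact_approx S g -> compact_approx S' (g \o h).
Proof.
move=> ch SS' Sg; apply: approx_idem => K e cK e0.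
have chK : compact (h @` K).
  by apply: continuous_compact => //; exact: continuous_subspaceT.
have [s Ss gs] := Sg _ _ chK e0.
by exists (s \o h); [exact: SS'|move=> x Kx /=; apply: gs; exists x].
Qed.

Section Density.
Context {R : realType} {T : topologicalType}.

(** At a continuous function, compact-open convergence is uniform convergence on compact sets, and
    [continuousType] has the topology induced from [T -> R]. *)
Lemma dense_approxP (S : set (T -> R)) : (forall s, S s -> continuous s) ->
  dense [set g : continuousType T R | S (g : T -> R)] <->
  (forall g : T -> R, continuous g -> compact_approx S g).
Proof.
move=> cS; split=> [dS g cg K e cK e0|dS O [g Og] oO].
  pose B := [set h : T -> R | forall x, K x -> `|g x - h x| < e].
  have Bg : nbhs (g : {compact-open, T -> R}) B.
    have /compact_open_fam_compactP :
      {compact-open, (nbhs (g : {compact-open, T -> R})) --> g} by [].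
    move=> /(_ cg _); apply.
    have := @fam_nbhs T R compact K [set xy : R * R | `|xy.1 - xy.2| < e] g.
    by apply => //; rewrite -entourage_ballE; exists e.
  have : nbhs (mkcts cg : continuousType T R) [set h : continuousType T R | B h].
    exact: (@initial_continuous _ _ (id : continuousType T R -> (T -> R)) (mkcts cg)).
  rewrite nbhsE => -[W [oW Wg] WB].
  have [h [Wh Sh]] := dS W (ex_intro _ _ Wg) oW.
  by exists h => //; exact: WB.
have : nbhs g O by exact: open_nbhs_nbhs.
rewrite nbhsE => -[_ [[U oU <-] Ug UO]].
(* The sets of functions within [e] of [g] on [K] form a filter base; [Fi] converges to [g], so the
   open set [U] contains one of them. *)
pose Fi := filter_from [set Ke : set T * R | compact Ke.1 /\ 0 < Ke.2]
  (fun Ke => [set h : T -> R | forall x, Ke.1 x -> `|g x - h x| < Ke.2]).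
have FF : Filter Fi.
  apply: filter_from_filter; first by exists (set0, 1); split => //; exact: compact0.
  move=> [K e] [K2 e2] [/= cK e0] [/= cK2 e20].
  exists (K `|` K2, Num.min e e2); first by split; [exact: compactU|rewrite lt_min e0].
  move=> h /= gh; split=> x Kx.
    by have := gh x (or_introl Kx); rewrite lt_min => /andP[].
  by have := gh x (or_intror Kx); rewrite lt_min => /andP[].
have cg : continuous g by exact: cts_fun.
have Fg : {compact-open, Fi --> (g : T -> R)}.
  apply/compact_open_fam_compactP => //; apply/fam_cvgP => K cK W.
  move=> /uniform_nbhs[E [entE EW]].
  move: entE; rewrite -entourage_ballE => -[e /= e0 eE].
  exists (K, e) => //= h gh; apply: EW => x Kx; apply: eE => /=; exact: gh.
have [[K e] [/= cK e0] KU] : Fi U.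
  apply: Fg; exact: open_nbhs_nbhs.
have [s Ss gs] := dS g cg K e cK e0.
exists (mkcts (cS s Ss)); split=> //; apply: UO; exact: KU.
Qed.

End Density.

(** * Stone-Weierstrass *)

Lemma compact_ubound {R : realType} {T : topologicalType} {K : set T} {g : T -> R} :
  compact K -> continuous g -> exists2 M : R, 0 < M & forall x, K x -> `|g x| <= M.
Proof.
move=> cK cg.
have /compact_bounded[M [_ gM]] : compact (g @` K).
  by apply: continuous_compact => //; exact: continuous_subspaceT.
exists (`|M| + 1); first by rewrite ltr_wpDl.
move=> x Kx; apply: gM; last by exists x.
by rewrite (le_lt_trans (ler_norm _))// ltrDl.
Qed.

(* Dini's argument: a downward directed family is a filter base. *)
Lemma compact_directed_lt {R : realType} {T : topologicalType} {K : set T}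
    (D : set (T -> R)) (f : T -> R) :
  compact K -> D !=set0 ->
  (forall u v, D u -> D v -> D (fun x => Num.min (u x) (v x))) ->
  (forall x, K x -> exists2 g, D g & \forall y \near x, g y < f y) ->
  exists2 g, D g & forall x, K x -> g x < f x.
Proof.
move=> /compact_near_coveringP cK D0 Dmin Df.
pose Fi := filter_from D (fun g0 => [set g | forall y, g y <= g0 y]).
have FF : Filter Fi.
  apply: filter_from_filter => // u v Du Dv.
  exists (fun x => Num.min (u x) (v x)); first exact: Dmin.
  by move=> g gle; split=> y; have := gle y; rewrite le_min => /andP[].
have [x Kx|g Dg /(_ g) gf] := cK _ Fi (fun g y => g y < f y) FF.
  have [g Dg gf] := Df x Kx.
  exists ([set y | g y < f y], [set h | forall y, h y <= g y]).
    by split => //=; exists g.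
  by move=> [y h] [/= gy hg]; exact: le_lt_trans (hg y) gy.
by exists g => // x Kx; exact: gf.
Qed.

Section StoneWeierstrass.
Context {R : realType} {T : topologicalType}.
Variable A : set (T -> R).
Hypothesis linA : lin_closed A.
Hypothesis mulA : forall u v, A u -> A v -> A (fun x => u x * v x).
Hypothesis oneA : A (cst 1).
Hypothesis contA : forall u, A u -> continuous u.
Hypothesis sepA : separates_points A.

(** This closure of [A] among continuous functions is shown to be a linear lattice, as the passage
    to minima below requires. *)
Let L : set (T -> R) := [set g | continuous g /\ compact_approx A g].

Let linL : lin_closed L.
Proof.
have linA' := approx_lin_closed linA.
split; first by split; [move=> x; exact: cvg_cst|exact: linA'.1].
move=> a u v [cu Au] [cv Av]; split; last exact: linA'.2.
by move=> x; apply: cvgD; [apply: cvgM; [exact: cvg_cst|exact: cu]|exact: cv].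
Qed.

Let mulL u v : L u -> L v -> L (fun x => u x * v x).
Proof.
move=> [cu Au] [cv Av]; split; first by move=> x; apply: cvgM; [exact: cu|exact: cv].
move=> K e cK e0.
have [M M0 uM] := compact_ubound cK cu; have [N N0 vN] := compact_ubound cK cv.
pose d := Num.min 1 (e / (M + N + 1)).
have d0 : 0 < d by rewrite lt_min ltr01/= divr_gt0// ltr_wpDl// addr_ge0// ltW.
have d1 : d <= 1 by rewrite ge_min lexx.
have de : d * (M + N + 1) <= e.
  by rewrite -ler_pdivlMr ?ge_min ?lexx ?orbT// ltr_wpDl// addr_ge0// ltW.
have [s As us] := Au K d cK d0; have [t At vt] := Av K d cK d0.
exists (fun x => s x * t x); first exact: mulA.
move=> x Kx; move: (us _ Kx) (vt _ Kx) (uM _ Kx) (vN _ Kx).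
move: (u x) (v x) (s x) (t x) => a b a' b' {}us {}vt {}uM {}vN.
(* Writing [b'] as [b - (b - b')] bounds it by [N + 1], because [d <= 1]; the total error is then
   below [d * (M + N + 1)]. *)
have -> : a * b - a' * b' = a * (b - b') + (a - a') * (b - (b - b')) by ring.
apply: lt_le_trans de; rewrite (le_lt_trans (ler_normD _ _))// !normrM.
have bN : `|b - (b - b')| <= N + 1.
  by rewrite (le_trans (ler_normB _ _))// lerD// (le_trans (ltW vt)).
have h1 : `|a| * `|b - b'| <= M * d by rewrite ler_pM// ltW.
have h2 : `|a - a'| * `|b - (b - b')| < d * (N + 1).
  by rewrite (@le_lt_trans _ _ (`|a - a'| * (N + 1)))// ?ler_wpM2l// ltr_pM2r// ltr_wpDl// ltW.
by rewrite -addrA mulrDr (mulrC d M); apply: ler_ltD.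
Qed.

(* The iterates [q' = q + (v^2 - q^2) / 2] increase uniformly to [|v|] where
   [|v| <= 1]. *)
Let absq (v : T -> R) :=
  fix q n : T -> R := if n is n'.+1 then
    q n' + 2^-1 *: ((fun x => v x * v x) - (fun x => q n' x * q n' x)) else 0.

Let absqL v n : L v -> L (absq v n).
Proof.
move=> Lv; elim: n => [|n IH] /=; first exact: linL.1.
apply: lin_closedD => //; apply: lin_closedZ => //; apply: lin_closedB => //; exact: mulL.
Qed.

(** The last bound is [|v| - q <= 2|v| / (2 + n|v|)] cleared of its denominator; it yields the rate
    [2 / n] independently of [x]. Each iteration multiplies the error [|v| - q] by
    [1 - (|v| + q) / 2], at most [1 - |v| / 2]. *)
Let absqP v n x : `|v x| <= 1 ->
  [/\ 0 <= absq v n x, absq v n x <= `|v x| &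
    (`|v x| - absq v n x) * (2 + n%:R * `|v x|) <= 2 * `|v x| ].
Proof.
move=> v1; have v0 := normr_ge0 (v x); elim: n => [|n [q0 qv IH]].
  by rewrite /= -[0 x]/(0 : R) subr0 mul0r addr0; split => //; rewrite mulrC.
have -> : absq v n.+1 x = absq v n x + 2^-1 * (`|v x| ^+ 2 - absq v n x ^+ 2).
  by rewrite /= !fctE /GRing.scale/= -!expr2 real_normK// num_real.
move: (absq v n x) (`|v x|) v0 v1 q0 qv IH => q y y0 y1 q0 qy IH.
have h : 0 <= (1 - (y + q) / 2) by lra.
have hq : y - (q + 2^-1 * (y ^+ 2 - q ^+ 2)) = (y - q) * (1 - (y + q) / 2) by field.
have n0 : 0 <= n%:R * y by rewrite mulr_ge0.
split.
- by rewrite addr_ge0// mulr_ge0// subr_ge0 lerXn2r ?nnegrE.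
- by rewrite -subr_ge0 hq mulr_ge0// subr_ge0.
- apply: le_trans IH; rewrite hq -mulrA ler_wpM2l ?subr_ge0//.
  apply: (@le_trans _ _ ((1 - y / 2) * (2 + n.+1%:R * y))).
    by rewrite ler_wpM2r ?addr_ge0 ?mulr_ge0//; lra.
  have : 0 <= n%:R * y * y + y * y by rewrite addr_ge0 ?mulr_ge0.
  move=> h2; rewrite -subr_ge0 -[n.+1%:R]natr1.
  have -> : 2 + n%:R * y - (1 - y / 2) * (2 + (n%:R + 1) * y) =
      (n%:R * y * y + y * y) / 2 by field.
  by rewrite divr_ge0.
Qed.

Let absL u : L u -> L (fun x => `|u x|).
Proof.
move=> Lu; have [cu Au] := Lu; split.
  by move=> x; apply: cvg_comp (cu x) _; exact: norm_continuous.
apply: approx_idem => K e cK e0.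
have [M M0 uM] := compact_ubound cK cu.
(* Scaled by [M], the error after [n.+1] iterations is at most [2 * M / n.+1], below [e] by this
   choice. *)
pose n := Num.truncn (2 * M / e).
exists (M *: absq (M^-1 *: u) n.+1).
  have /(absqL n.+1)/(lin_closedZ M linL)[] // : L (M^-1 *: u) by exact: lin_closedZ.
move=> x Kx; have v1 : `|(M^-1 *: u) x| <= 1.
  by rewrite fctE normrM normfV (gtr0_norm M0) ler_pdivrMl// mulr1 uM.
have [q0 qv] := absqP n.+1 v1.
have -> : `|u x| = M * `|(M^-1 *: u) x|.
  by rewrite fctE normrM normfV (gtr0_norm M0) mulVKf// gt_eqF.
rewrite (_ : (M *: absq (M^-1 *: u) n.+1) x = M * absq (M^-1 *: u) n.+1 x)//.
move: (`|(M^-1 *: u) x|) (absq _ _ x) (normr_ge0 ((M^-1 *: u) x)) q0 qv => y q y0 q0 qy h.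
rewrite -mulrBr ger0_norm ?mulr_ge0 ?subr_ge0 ?(ltW M0)//.
have [yE|yn0] := eqVneq y 0.
  have -> : y - q = 0 by lra.
  by rewrite mulr0.
have {}y0 : 0 < y by rewrite lt_def yn0.
have nM : 2 * M / e < n.+1%:R by rewrite truncnS_gt.
have h' : (y - q) * n.+1%:R <= 2.
  rewrite -(ler_pM2r y0) -mulrA (le_trans _ h)// ler_wpM2l ?subr_ge0//; lra.
have n0 : 0 < n.+1%:R :> R by [].
rewrite -(ltr_pM2r n0) -mulrA (@le_lt_trans _ _ (M * 2))// ?ler_pM2l//.
by move: nM; rewrite ltr_pdivrMr// mulrC (mulrC e).
Qed.

Let minL u v : L u -> L v -> L (fun x => Num.min (u x) (v x)).
Proof.
move=> Lu Lv; under eq_fun do rewrite minr_absE.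
rewrite (_ : (fun _ => _) = 2^-1 *: (u + v - (fun x => `|(u - v) x|))); last first.
  by apply/funext => x; rewrite !fctE /GRing.scale/= mulrC.
apply: lin_closedZ => //; apply: lin_closedB => //; first exact: lin_closedD.
by apply: absL; exact: lin_closedB.
Qed.

Let interp (f : T -> R) x y : exists2 g, L g & g x = f x /\ g y = f y.
Proof.
have AL u : A u -> L u by move=> Au; split; [exact: contA|exact: sub_approx].
have [<-|xy] := pselect (x = y).
  exists (f x *: cst 1); first exact/AL/lin_closedZ.
  by rewrite !fctE /GRing.scale/= mulr1.
have [p Ap pxy] := sepA xy.
exists (f x *: cst 1 + ((f y - f x) / (p y - p x)) *: (p - p x *: cst 1)).
  apply/AL/lin_closedD => //; first exact: lin_closedZ.
  by apply/lin_closedZ/lin_closedB => //; exact: lin_closedZ.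
have pyx : p y - p x != 0 by rewrite subr_eq0 eq_sym; apply/eqP.
by rewrite !fctE /GRing.scale/= !mulr1 subrr mulr0 addr0 divfK// addrC subrK.
Qed.

Lemma stone_weierstrass (f : T -> R) : continuous f -> compact_approx A f.
Proof.
move=> cf; apply: (@approx_idem _ _ A) => K e cK e0.
have near_lt (g : T -> R) (h : T -> R) x : continuous g -> continuous h ->
    g x < h x + e -> \forall y \near x, g y < h y + e.
  move=> cg ch gh; have : (h y + e - g y) @[y --> x] --> h x + e - g x.
    by apply: cvgB; [apply: cvgD; [exact: ch|exact: cvg_cst]|exact: cg].
  move=> /(_ [set z | 0 < z]); rewrite /= => hg; near do rewrite -subr_gt0.
  apply: hg; apply: open_nbhs_nbhs; split; first exact: open_gt.
  by rewrite /= subr_gt0.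
(* Minima of interpolants through [x] push the function below [f + e] on all of [K] while keeping
   its value at [x]. *)
have step x : exists2 g, L g & g x = f x /\ forall y, K y -> g y < f y + e.
  have [||u v [Lu ux] [Lv vx]|y Ky|g [Lg gx] gf] :=
    @compact_directed_lt _ _ K [set g | L g /\ g x = f x] (fun y => f y + e) => //.
  - by have [g Lg [gx _]] := interp f x x; exists g.
  - by split; [exact: minL|rewrite ux vx minxx].
  - have [g Lg [gx gy]] := interp f x y; exists g => //.
    by apply: near_lt => //; [exact: Lg.1|rewrite gy ltrDl].
  - by exists g.
have linN u : L u -> L (- u) by move=> Lu; rewrite -scaleN1r; exact: lin_closedZ.
(* Maxima of the functions from [step] are treated as minima of their negatives, so the same Dini
   argument applies. *)
have [||u v [Lu uf] [Lv vf]|x Kx|g [Lg gf] gf'] :=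
  @compact_directed_lt _ _ K
    [set h | L h /\ forall y, K y -> - h y < f y + e] (fun y => - f y + e) => //.
- have [[x Kx]|K0] := pselect (exists x, K x); last first.
    exists 0; split; [exact: linL.1|by move=> y Ky; exfalso; apply: K0; exists y].
  have [g Lg [_ gf]] := step x; exists (- g); split; first exact: linN.
  by move=> y Ky; rewrite fctE opprK; exact: gf.
- split; first exact: minL.
  by move=> y Ky; rewrite /Num.min; case: ifP => _; [exact: uf|exact: vf].
- have [g Lg [gx gf]] := step x; exists (- g).
    by split; [exact: linN|move=> y Ky; rewrite fctE opprK; exact: gf].
  apply: near_lt; [exact: (linN _ Lg).1|by move=> y; apply: cvgN; exact: cf|].
  by rewrite fctE gx ltrDl.
exists (- g); first by have [] := linN _ Lg.
move=> x Kx; rewrite fctE opprK ltr_norml; have := gf x Kx; have := gf' x Kx; lra.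
Unshelve. all: by end_near. Qed.

End StoneWeierstrass.

(** * Primitives and finite differences *)

Section Calculus.
Context {R : realType}.
Implicit Types (f g F : R -> R) (x h u : R).

(** The oriented integral from 0 to [x], as a difference of two integrals whose common lower end
    lies below both 0 and [x]; integrals over intervals carry no orientation. *)
Definition primitive f x : R :=
  let I (y : R) := \int[lebesgue_measure]_(t in `[- (`|x| + 1), y]) f t in I x - I 0.

Let continuous_integrable f a b : continuous f ->
  lebesgue_measure.-integrable `[a, b] (EFin \o f).
Proof.
move=> cf; apply: continuous_compact_integrable; first exact: segment_compact.
exact: continuous_subspaceT.
Qed.

(** The part left of [- |x|] cancels, so a lower end fixed for all points near [x] can replace the
    moving one. *)
Let primitiveE f x (a : R) : continuous f -> `|x| < a ->
  primitive f x = \int[lebesgue_measure]_(t in `[- a, x]) f t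
    - \int[lebesgue_measure]_(t in `[- a, 0]) f t.
Proof.
move=> cf xa; rewrite /primitive; set c := `|x| + 1.
have x0 := normr_ge0 x.
have key d y : `|x| < d -> - `|x| <= y -> - `|x| <= 0 ->
    \int[lebesgue_measure]_(t in `[- d, y]) f t =
    \int[lebesgue_measure]_(t in `[- d, - `|x|]) f t +
    \int[lebesgue_measure]_(t in `](- `|x|), y]) f t.
  move=> xd xy _; rewrite -(@Rintegral_itvB _ f (BLeft (- d)) (BRight y) (- `|x|)).
  - by rewrite addrC subrK.
  - exact: continuous_integrable.
  - by rewrite bnd_simp lerN2 ltW.
  - by rewrite bnd_simp.
have xc : `|x| < c by rewrite ltrDl.
have nx : - `|x| <= x by rewrite lerNl ler_normr lexx orbT.
have n0 : - `|x| <= 0 by rewrite oppr_le0.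
by rewrite !(key _ x)// !(key _ 0)//; ring.
Qed.

Lemma is_derive_primitive f x : continuous f -> is_derive x 1 (primitive f) (f x).
Proof.
move=> cf; pose a : R := `|x| + 1.
pose I (y : R) : R := \int[lebesgue_measure]_(t in `[- a, y]) f t.
have xa : `|x| < a by rewrite ltrDl.
apply: (@near_eq_is_derive R R R (fun y => I y - I 0)).
  have : \forall y \near x, `|y| < a.
    by have /cvgr_lt/(_ _ xa) := @norm_continuous _ R x.
  by apply: filterS => y ya; rewrite (primitiveE cf ya).
have [dI I'] : derivable I x 1 /\ derive1 I x = f x.
  apply: (@continuous_FTC1_closed _ f (- a) x (x + 1)).
  - by rewrite ltrDl.
  - exact: continuous_integrable.
  - by rewrite (lt_le_trans (_ : _ < - `|x|)) ?ltrN2// lerNl ler_normr lexx orbT.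
  - exact: cf.
rewrite -I' derive1E -[X in is_derive _ _ _ X]subr0.
apply: is_deriveB; apply: derivableP => //.
Qed.

Lemma is_derive_continuous F f :
  (forall x, is_derive x 1 F (f x)) -> continuous F.
Proof.
by move=> dF x; apply: differentiable_continuous; apply/derivable1_diffP; have [] := dF x.
Qed.

Lemma mean_value F f x u : (forall x, is_derive x 1 F (f x)) ->
  exists2 c, `|c - x| <= `|u| & F (x + u) - F x = u * f c.
Proof.
move=> dF; have cF := is_derive_continuous dF.
have [u0|/ltW u0] := leP 0 u.
  have xu : x <= x + u by rewrite lerDl.
  have [c] := MVT_segment xu (fun y _ => dF y) (continuous_subspaceT cF).
  rewrite in_itv/= => /andP[c1 c2] ->; exists c; last by ring.
  by rewrite !ger0_norm ?subr_ge0// lerBlDl.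
have xu : x + u <= x by rewrite gerDl.
have [c] := MVT_segment xu (fun y _ => dF y) (continuous_subspaceT cF).
rewrite in_itv/= => /andP[c1 c2] /eqP; rewrite subr_eq => /eqP ->; exists c; last by ring.
by rewrite !ler0_norm ?subr_le0// opprB; lra.
Qed.

Definition fdiff h f : R -> R := fun x => f (x + h) - f x.

Lemma fdiff_continuous h f k : continuous f -> continuous (iter k (fdiff h) f).
Proof.
move=> cf; elim: k => [//|k IH] x /=; apply: cvgB; last exact: IH.
apply: (@cvg_comp _ _ _ (fun y => y + h) (iter k (fdiff h) f)); last exact: IH.
by apply: cvgD; [exact: cvg_id|exact: cvg_cst].
Qed.

Lemma is_derive_fdiff h f F k : (forall x, is_derive x 1 F (f x)) ->
  forall x, is_derive x 1 (iter k (fdiff h) F) (iter k (fdiff h) f x).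
Proof.
move=> dF; elim: k => [//|k IH] x /=.
apply: is_deriveB.
rewrite -[X in is_derive _ _ _ X]mulr1.
apply: (@is_derive1_comp _ (iter k (fdiff h) F) (fun y => y + h)).
rewrite -[X in is_derive _ _ _ X]addr0.
exact: is_deriveD.
Qed.

(** Applying [fdiff u] to every [H j] gives a chain to which induction applies; one more mean value
    trades the remaining difference for a factor [u] and a displacement of at most [|u|]. *)
Lemma iter_fdiff_mean_value (H : nat -> R -> R) k x u :
  (forall j (y : R), (j < k)%N -> is_derive y 1 (H j) (H j.+1 y)) ->
  exists2 c, `|c - x| <= k%:R * `|u| & iter k (fdiff u) (H 0%N) x = u ^+ k * H k c.
Proof.
elim: k H => [|k IH] H dH.
  by exists x; rewrite ?subrr ?normr0 ?mul0r// expr0 mul1r.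
have [j y jk|c cx] := IH (fun j => fdiff u (H j)).
  by apply: (@is_derive_fdiff u (H j.+1) (H j) 1) => z; apply: dH; exact: ltnW.
rewrite -iterSr => ->.
have [d dc] := @mean_value _ _ c u (fun y => dH k y (ltnSn k)).
rewrite /fdiff => ->; exists d; last by rewrite exprSr mulrA.
rewrite -(subrKA c) (le_trans (ler_normD _ _))// -natr1 mulrDl mul1r addrC.
exact: lerD.
Qed.

(** Only [x] is confined to [K], so the intermediate point of a mean value may leave it. *)
Lemma compact_unif_continuous (K : set R) f e : compact K -> continuous f -> 0 < e ->
  exists2 d, 0 < d & forall x y, K x -> `|y - x| < d -> `|f y - f x| < e.
Proof.
move=> /compact_near_coveringP cK cf e0.
have := cK _ (nbhs (0 : R)^'+) (fun d x => forall y, `|y - x| < d -> `|f y - f x| < e).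
case=> [|d /= d0 dP].
- move=> x Kx.
  have [d /= d0 fd] : \forall y \near x, `|f x - f y| < e / 2.
    by have /cvgrPdist_lt/(_ (e / 2)) := cf x; apply; rewrite divr_gt0.
  exists (ball x (d / 2), [set t | t < d / 2]).
    split; first by apply: nbhsx_ballx; rewrite divr_gt0.
    by apply: nbhs_right_lt; rewrite divr_gt0.
  move=> [y t] [/= xy td] z zy.
  have h1 : `|f x - f z| < e / 2.
    apply: fd; rewrite /= -(subrKA y) (splitr d) (le_lt_trans (ler_normD _ _))// ltrD//.
    by rewrite distrC (lt_trans zy).
  have h2 : `|f x - f y| < e / 2.
    by apply: fd; rewrite /= (lt_le_trans xy)// ler_pdivrMr// ler_peMr ?ler1n ?ltW.
  by rewrite -(subrKA (f x)) (splitr e) (le_lt_trans (ler_normD _ _))// ltrD// distrC.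
have d2 : 0 < d / 2 by rewrite divr_gt0.
exists (d / 2) => // x y Kx; apply: (dP (d / 2)) => //=.
by rewrite sub0r normrN gtr0_norm// ltr_pdivrMr// ltr_pMr// ltr1n.
Qed.

End Calculus.

(** * Iterated differences and Frechet's functional equation *)

Section Frechet.
Context {R : realType}.

Definition ndiff (u : nat -> R) : nat -> R := fun j => u j.+1 - u j.

Lemma iter_ndiff_grid k (f : R -> R) (a h : R) j :
  iter k ndiff (fun i => f (a + i%:R * h)) j = iter k (fdiff h) f (a + j%:R * h).
Proof.
elim: k j => [//|k IH] j /=; rewrite /ndiff !IH /fdiff.
by rewrite -natr1 mulrDl mul1r addrA.
Qed.

(** Newton's forward formula: the case of [ndiff u] supplies the increments of [u], and Pascal's
    rule sums them. *)
Lemma newton_forward k (u : nat -> R) : (forall j, iter k ndiff u j = 0) ->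
  forall j, u j = \sum_(i < k) 'C(j, i)%:R * iter i ndiff u 0%N.
Proof.
elim: k u => [|k IH] u; first by move=> /= u0 j; rewrite u0 big_ord0.
move=> uk; have du j : ndiff u j = \sum_(i < k) 'C(j, i)%:R * iter i.+1 ndiff u 0%N.
  rewrite (IH (ndiff u)) => [|j']; last by rewrite -iterSr uk.
  by apply: eq_bigr => i _; rewrite -iterSr.
elim=> [|j IHj].
  rewrite big_ord_recl bin0 mul1r big1 ?addr0// => i _.
  by rewrite bin0n mul0r.
rewrite -[LHS](subrK (u j)) -/(ndiff u j) du IHj !big_ord_recl !bin0 addrCA -big_split/=.
by congr (_ + _); apply: eq_bigr => i _; rewrite /bump/= !add1n binS natrD mulrDl addrC.
Qed.

Fixpoint binom_poly (i : nat) : {poly R} :=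
  if i is i'.+1 then binom_poly i' * ('X - i'%:R%:P) * (i'.+1%:R^-1)%:P else 1.

Lemma binom_polyE i (j : nat) : (binom_poly i).[j%:R] = 'C(j, i)%:R.
Proof.
elim: i => [|i IH] /=; first by rewrite hornerC bin0.
rewrite !hornerE IH; apply: (@mulIf _ i.+1%:R); first by rewrite pnatr_eq0.
rewrite divfK ?pnatr_eq0// -natrM mulnC mul_bin_left.
have [ij|ji] := leqP i j; first by rewrite -natrB// -natrM mulnC.
by rewrite bin_small// mul0r muln0.
Qed.

Lemma ndiff_eq0_poly k (u : nat -> R) : (forall j, iter k ndiff u j = 0) ->
  exists p : {poly R}, forall j, u j = p.[j%:R].
Proof.
move=> uk; exists (\sum_(i < k) iter i ndiff u 0%N *: binom_poly i) => j.
rewrite (newton_forward uk) horner_sum; apply: eq_bigr => i _.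
by rewrite hornerZ binom_polyE mulrC.
Qed.

Lemma poly_eq_nat (p q : {poly R}) : (forall j : nat, p.[j%:R] = q.[j%:R]) -> p = q.
Proof.
move=> pq; apply/eqP; rewrite -subr_eq0; apply/eqP.
apply: (@roots_geq_poly_eq0 _ _ [seq i%:R | i <- iota 0 (size (p - q))]).
- by apply/allP => _ /mapP[i _ ->]; rewrite /root !hornerE pq subrr.
- by rewrite map_inj_uniq ?iota_uniq// => i j /eqP; rewrite eqr_nat => /eqP.
- by rewrite size_map size_iota.
Qed.

(** Newton's formula makes [f] polynomial on each arithmetic progression. Those refining the
    integers all give the same polynomial, determined by its values at the naturals; hence [f = p]
    on the rationals, and everywhere by continuity. *)
Lemma fdiff_eq0_poly k (f : R -> R) : continuous f ->
  (forall h x, iter k (fdiff h) f x = 0) -> is_polynomial f.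
Proof.
move=> cf fk.
have grid (a h : R) : exists p : {poly R}, forall j, f (a + j%:R * h) = p.[j%:R].
  by apply: (@ndiff_eq0_poly k) => j; rewrite (iter_ndiff_grid k f a h) fk.
have [p fp] := grid 0 1; exists p.
have fpZ (N n j : nat) : (0 < n)%N ->
    f (- N%:R + j%:R * n%:R^-1) = p.[- N%:R + j%:R * n%:R^-1].
  move=> n0; have nn0 : n%:R != 0 :> R by rewrite pnatr_eq0 -lt0n.
  have [q fq] := grid (- N%:R) n%:R^-1.
  (* Index [n * (i + N)] of the fine grid is the natural number [i], where both polynomials give
     [f]. *)
  suff <- : q \Po (n%:R%:P * ('X + N%:R%:P)) = p.
    rewrite horner_comp !hornerE fq; congr (q.[_]).
    by rewrite addrC addrA subrr add0r mulrCA mulfV// mulr1.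
  apply: poly_eq_nat => i; rewrite horner_comp !hornerE.
  have -> : n%:R * (i%:R + N%:R) = (n * (i + N))%:R :> R by rewrite natrM natrD.
  rewrite -fq -fp; congr (f _).
  by rewrite natrM natrD mulrAC mulfV// mul1r mulr1 add0r addrC addrK.
have fpQ (r : rat) : f (ratr r) = p.[ratr r].
  pose n := `|denq r|%N; pose N := `|numq r|%N.
  have n0 : (0 < n)%N by rewrite absz_gt0 denq_neq0.
  pose j := absz (numq r + N%:Z * n%:Z).
  suff -> : ratr r = - N%:R + j%:R * n%:R^-1 :> R by exact: fpZ.
  have nn0 : n%:R != 0 :> R by rewrite pnatr_eq0 -lt0n.
  have jE : j%:R = (numq r)%:~R + N%:R * n%:R :> R.
    have jZ : j%:Z = numq r + N%:Z * n%:Z.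
      rewrite /j gez0_abs// -(opprK (numq r)) addrC subr_ge0.
      rewrite (le_trans (ler_norm _))// normrN -abszE -/N.
      by rewrite -PoszM lez_nat leq_pmulr.
    by rewrite -[LHS]/(j%:Z%:~R) jZ rmorphD/= rmorphM.
  rewrite jE mulrDl mulfK// addrC addrK /ratr; congr (_ / _).
  by rewrite -[RHS]/(n%:Z%:~R) /n gez0_abs// denq_ge0.
move=> t; apply/eqP; rewrite -subr_eq0; apply/negPn/negP => ft.
have cfp : continuous (fun t => f t - p.[t]).
  by move=> x; apply: cvgB; [exact: cf|exact: continuous_horner].
have oW : open ((fun t => f t - p.[t]) @^-1` [set y | y != 0]).
  by apply: open_comp => [x _|]; [exact: cfp|exact: open_neq].
have [z [/= Wr [r _ rE]]] := @dense_rat R _ (ex_intro _ t ft) oW.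
by move: Wr; rewrite -rE fpQ subrr eqxx.
Qed.

End Frechet.

Section FiniteDifferences.
Context {R : realType}.
Implicit Types (u v : nat -> R).

Lemma iter_ndiff_lin k (a : R) u v j :
  iter k ndiff (fun i => a * u i + v i) j = a * iter k ndiff u j + iter k ndiff v j.
Proof. by elim: k j => [//|k IH] j /=; rewrite /ndiff !IH; ring. Qed.

Lemma iter_ndiff_bound k u (e : R) i : (forall j, (j <= k)%N -> `|u (i + j)%N| <= e) ->
  `|iter k ndiff u i| <= 2 ^+ k * e.
Proof.
elim: k i => [|k IH] i ue /=; first by rewrite mul1r -[i]addn0 ue.
rewrite /ndiff (le_trans (ler_normB _ _))// exprS -mulrA mulr_natl mulr2n lerD// IH//.
  by move=> j jk; rewrite addSnnS ue.
by move=> j jk; rewrite ue// ltnW.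
Qed.

Lemma iter_ndiff_delta k u : (forall j, u j = (j == 0)%:R) ->
  iter k ndiff u 0%N = (-1) ^+ k.
Proof.
move=> u0; suff : iter k ndiff u 0%N = (-1) ^+ k /\ forall j, iter k ndiff u j.+1 = 0.
  by case.
elim: k => [|k [IH0 IH]] /=; first by rewrite u0; split => // j; rewrite u0.
by rewrite /ndiff IH0 IH sub0r exprS mulN1r; split => // j; rewrite !IH subrr.
Qed.

(** The mean value formula of order [size p] turns the difference into a multiple of the derivative
    of that order, which is zero because [size p] exceeds the degree. *)
Lemma iter_ndiff_poly (p : {poly R}) (a b : R) :
  iter (size p) ndiff (fun j => p.[a * j%:R + b]) 0%N = 0.
Proof.
pose H j t := a ^+ j * (derivn j p).[a * t + b].
have dH j (y : R) : (j < size p)%N -> is_derive y 1 (H j) (H j.+1 y).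
  move=> _; rewrite /H derivnS exprSr -mulrA.
  have d1 : is_derive y 1 (fun t => a * t + b) a.
    rewrite -[X in is_derive _ _ _ X]addr0 -[X in is_derive _ _ _ (X + _)]mulr1.
    by apply: is_deriveD; exact: is_deriveZ.
  have d2 : is_derive (a * y + b) 1 (horner (derivn j p)) (derivn j p)^`().[a * y + b].
    by rewrite derivE derive1E; apply: derivableP; exact: derivable_horner.
  rewrite [a * _]mulrC.
  exact: (@is_deriveZ _ _ _ (fun t => (derivn j p).[a * t + b]) (a ^+ j)).
transitivity (iter (size p) (fdiff 1) (H 0%N) (0 + 0%:R * 1)).
  rewrite -iter_ndiff_grid; congr (iter _ _ _ _); apply/funext => j.
  by rewrite /H mul1r add0r mulr1.
have [c _ ->] := iter_fdiff_mean_value (0 + 0%:R * 1) 1 dH.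
by rewrite /H derivn_poly0// horner0 !mulr0.
Qed.

End FiniteDifferences.

(** * Affinely invariant closed spaces of univariate functions *)

Section Univariate.
Context {R : realType}.
Variable V : set (R -> R).
Hypothesis linV : lin_closed V.
Hypothesis approxV : compact_approx V `<=` V.
Hypothesis affV : forall g (a b : R), V g -> V (fun t => g (a * t + b)).

Let transV g (b : R) : V g -> V (fun t => g (t + b)).
Proof.
by move=> /(affV 1 b); under eq_fun do rewrite mul1r.
Qed.

(* [G (x + h) - G x] is the integral of [g] over [[x, x + h]], hence a limit of
   Riemann sums of translates of [g]. *)
Lemma fdiff_primitive_closed (h : R) (G g : R -> R) : continuous g ->
  (forall x : R, is_derive x 1 G (g x)) -> V g -> V (fdiff h G).
Proof.
move=> cg dG Vg; apply: approxV => K e cK e0.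
have [M M0 KM] := compact_ubound cK (fun x => @cvg_id _ (nbhs (x : R))).
(* [[- B, B]] contains every sample point [z x i] with [x] in [K]; the [+ 1] in [|h| + 1] covers
   [h = 0]. *)
pose B := M + `|h|.
have h1 : 0 < `|h| + 1 by rewrite ltr_wpDl.
have [d d0 gd] := @compact_unif_continuous _ `[- B, B] g (e / (`|h| + 1))
  (@segment_compact _ _ _) cg (divr_gt0 e0 h1).
pose n := (Num.truncn (`|h| / d)).+1.
have n0 : 0 < n%:R :> R by rewrite ltr0n.
have nd : `|h| / n%:R < d.
  by rewrite ltr_pdivrMr// mulrC -ltr_pdivrMr// truncnS_gt.
pose z x i : R := x + i%:R * (h / n%:R).
exists (\sum_(i < n) (h / n%:R) *: (fun x => g (z x i))).
  by apply: lin_closed_sum => // i; apply: lin_closedZ => //; exact: transV.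
move=> x Kx; rewrite fct_sumE.
(* Telescoping pairs each Riemann term with one increment of [G]; the [n] errors add up to at most
   [|h| * (e / (|h| + 1)) < e]. *)
have -> : fdiff h G x = \sum_(i < n) (G (z x i.+1) - G (z x i)).
  rewrite -(big_mkord xpredT (fun i => G (z x i.+1) - G (z x i))).
  rewrite telescope_sumr// /fdiff /z mul0r addr0.
  by rewrite mulrC divfK// gt_eqF.
rewrite -sumrB (le_lt_trans (ler_norm_sum _ _ _))//.
have term (i : 'I_n) :
    `|G (z x i.+1) - G (z x i) - h / n%:R * g (z x i)|
      <= `|h| / n%:R * (e / (`|h| + 1)).
  have -> : z x i.+1 = z x i + h / n%:R.
    by rewrite /z -natr1 mulrDl mul1r addrA.
  have [c cz ->] := mean_value (z x i) (h / n%:R) dG.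
  rewrite -mulrBr normrM.
  have hn : `|h / n%:R| = `|h| / n%:R by rewrite normrM normfV (gtr0_norm n0).
  rewrite hn in cz *; rewrite ler_wpM2l ?divr_ge0 ?(ltW n0)//; apply: ltW.
  apply: gd; last exact: le_lt_trans cz nd.
  rewrite /= in_itv/= -ler_norml /z (le_trans (ler_normD _ _))// lerD ?KM//.
  rewrite normrM hn mulrCA ler_piMr// ger0_norm// ler_pdivrMr// mul1r ler_nat.
  exact/ltnW.
rewrite (le_lt_trans (ler_sum _ (fun i _ => term i)))// sumr_const card_ord.
rewrite -[X in X < _]mulr_natr mulrAC divfK ?gt_eqF//.
by rewrite mulrCA gtr_pMr// ltr_pdivrMr// mul1r ltrDl.
Qed.

Lemma continuous_iter_primitive (f : R -> R) k :
  continuous f -> continuous (iter k primitive f).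
Proof.
move=> cf; elim: k => [//|k IH] /=.
by apply: is_derive_continuous => x; exact: is_derive_primitive.
Qed.

(** Differences commute with differentiation, so the [k]-fold difference of the next primitive is a
    primitive of the function already in [V], and one further difference lands in [V]. *)
Lemma fdiff_iter_primitive_closed (h : R) (f : R -> R) k : continuous f -> V f ->
  V (iter k (fdiff h) (iter k primitive f)).
Proof.
move=> cf Vf; elim: k => [//|k IH]; rewrite iterS.
apply: fdiff_primitive_closed IH.
  by apply: fdiff_continuous; exact: continuous_iter_primitive.
apply: is_derive_fdiff => x; apply: is_derive_primitive.
exact: continuous_iter_primitive.
Qed.

(** A difference of step [s * t] in the argument [a * t + b] is a difference of step [s] in the
    dilation factor [a], hence a combination of dilates of [g]. *)
Lemma fdiff_dilation_closed g (s b : R) k : V g ->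
  forall a, V (fun t => iter k (fdiff (s * t)) g (a * t + b)).
Proof.
move=> Vg; elim: k => [|k IH] a /=; first exact: affV.
have := lin_closedB linV (IH (a + s)) (IH a).
by congr V; apply/funext => t; rewrite !fctE /fdiff mulrDl addrAC.
Qed.

(* The k-th difference quotient [s^-k Delta_{st}^k g (b)] tends to
   [t^k g^(k)(b)] as [s -> 0], for [g] the k-th h-difference of the k-th
   primitive of [f]; its k-th derivative is the k-th h-difference of [f]. *)
Lemma monomial_closed (f : R -> R) k h b : continuous f -> V f ->
  iter k (fdiff h) f b != 0 -> V (fun t => t ^+ k).
Proof.
move=> cf Vf c0; set c := iter k (fdiff h) f b in c0.
pose H j := iter k (fdiff h) (iter (k - j) primitive f).
have VH : V (H 0%N) by rewrite /H subn0; exact: fdiff_iter_primitive_closed.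
have dH j (y : R) : (j < k)%N -> is_derive y 1 (H j) (H j.+1 y).
  move=> jk; apply: is_derive_fdiff => x; rewrite -(subnSK jk) iterS; apply: is_derive_primitive.
  exact: continuous_iter_primitive.
have HkE : H k = iter k (fdiff h) f by rewrite /H subnn.
have cH : continuous (H k) by rewrite HkE; exact: fdiff_continuous.
have -> : (fun t => t ^+ k) = c^-1 *: (fun t : R => c * t ^+ k).
  by apply/funext => t; rewrite fctE /GRing.scale/= mulKf.
apply: lin_closedZ => //; apply: approxV => K e cK e0.
have [M M0 KM] := compact_ubound cK (fun x => @cvg_id _ (nbhs (x : R))).
have Mk : 0 < M ^+ k + 1 by rewrite ltr_wpDl// exprn_ge0// ltW.
have /cvgrPdist_lt/(_ _ (divr_gt0 e0 Mk))[d /= d0 Hd] := cH b.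
(* The intermediate point is within [k * s * |t| <= s * (k * M) < d] of [b], where [H k] is close to
   [c]; the added 1 covers [k = 0]. *)
pose s := d / (k%:R * M + 1).
have kM : 0 < k%:R * M + 1 by rewrite ltr_wpDl// mulr_ge0// ltW.
have s0 : 0 < s by rewrite divr_gt0.
have sd : s * (k%:R * M) < d by rewrite /s mulrAC ltr_pdivrMr// ltr_pM2l// ltrDl.
clearbody s.
exists ((s ^- k) *: (fun t => iter k (fdiff (s * t)) (H 0%N) (0 * t + b))).
  by apply: lin_closedZ => //; exact: fdiff_dilation_closed.
move=> t Kt; rewrite -[X in _ - X]/(s ^- k * iter k (fdiff (s * t)) (H 0%N) (0 * t + b)).
rewrite mul0r add0r.
have [x xb ->] := iter_fdiff_mean_value b (s * t) dH.
rewrite exprMn -mulrA mulKf ?expf_neq0 ?gt_eqF// [c * _]mulrC -mulrBr.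
rewrite normrM normrX.
have tM := KM t Kt.
have hc : `|c - H k x| < e / (M ^+ k + 1).
  rewrite /c -HkE; apply: Hd => /=; rewrite distrC (le_lt_trans xb)//.
  rewrite normrM (gtr0_norm s0) mulrCA (le_lt_trans _ sd)//.
  by rewrite ler_wpM2l ?(ltW s0)// ler_wpM2l.
rewrite (@le_lt_trans _ _ (M ^+ k * (e / (M ^+ k + 1))))//.
  by rewrite ler_pM ?exprn_ge0 ?lerXn2r ?nnegrE ?(ltW M0) ?(ltW hc).
by rewrite mulrCA gtr_pMr// ltr_pdivrMr// mul1r ltrDl.
Qed.

(** Tails are compared term by term, so the single point [M] controls the exponential series on
    [[- M, M]]. *)
Lemma expR_series_dist (M x : R) n : `|x| <= M ->
  `|expR x - series (exp_coeff x) n| <= expR M - series (exp_coeff M) n.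
Proof.
move=> xM.
have cx := is_cvg_series_exp_coeff x; have cM := is_cvg_series_exp_coeff M.
have h1 : `|series (exp_coeff x) m - series (exp_coeff x) n| @[m --> \oo]
    --> `|expR x - series (exp_coeff x) n|.
  by apply: cvg_norm; apply: cvgB; [exact: cx|exact: cvg_cst].
have h2 : series (exp_coeff M) m - series (exp_coeff M) n @[m --> \oo]
    --> expR M - series (exp_coeff M) n.
  by apply: cvgB; [exact: cM|exact: cvg_cst].
apply: (ler_cvg_to h1 h2); near=> m.
have nm : (n <= m)%N by near: m; exact: nbhs_infty_ge.
rewrite !sub_series_geq// (le_trans (ler_norm_sum _ _ _))// ler_sum// => i _.
rewrite /exp_coeff/= normrM normfV normrX (ger0_norm (ler0n _ _)) ler_wpM2r ?invr_ge0//.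
by rewrite lerXn2r ?nnegrE// (le_trans _ xM).
Unshelve. all: by end_near. Qed.

Lemma expR_closed (f : R -> R) : continuous f -> V f -> ~ is_polynomial f -> V expR.
Proof.
move=> cf Vf npf.
have Vk k : V (fun t => t ^+ k).
  have [[h [b c0]]|nc] := pselect (exists h b, iter k (fdiff h) f b != 0).
    exact: monomial_closed c0.
  case: npf; apply: (@fdiff_eq0_poly _ k) => // h b; apply/eqP/negPn/negP => hb.
  by apply: nc; exists h, b.
apply: approxV => K e cK e0.
have [M M0 KM] := compact_ubound cK (fun x => @cvg_id _ (nbhs (x : R))).
have /cvgrPdist_lt/(_ _ e0)[n _ /(_ n (leqnn n)) /= nM] := @is_cvg_series_exp_coeff R M.
exists (\sum_(i < n) i`!%:R^-1 *: (fun t => t ^+ i)).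
  by apply: lin_closed_sum => // i; exact: lin_closedZ.
move=> x Kx; have -> : (\sum_(i < n) i`!%:R^-1 *: (fun t : R => t ^+ i)) x = series (exp_coeff x) n.
  rewrite fct_sumE /series/= big_mkord; apply: eq_bigr => i _.
  by rewrite exp_coeffE.
rewrite (le_lt_trans (expR_series_dist n (KM _ Kx)))//.
by rewrite (le_lt_trans (ler_norm _)).
Qed.

End Univariate.

(** * Topological vector spaces are completely regular *)

Section UniformStructure.
Context {R : realType} {E : topologicalLmodType R}.

(** The translation-invariant uniformity of the additive group of [E]. *)
Definition tvs_entourage : set_system (E * E) :=
  [set P | exists2 U : set E, nbhs (0 : E) U & forall xy, U (xy.1 - xy.2) -> P xy].

Let sub_cvg (x y : E) (U : set E) : nbhs (x - y) U ->
  \forall z \near x & t \near y, U (z - t).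
Proof. exact: (@sub_continuous E (x, y)). Qed.

Let subl_cvg (x y : E) (U : set E) : nbhs (x - y) U -> \forall t \near y, U (x - t).
Proof.
move=> /sub_cvg[[P Q] [/= xP yQ] PQ]; apply: filterS yQ => t Qt.
by apply: (PQ (x, t)); split=> //=; exact: nbhs_singleton.
Qed.

Lemma tvs_entourage_filter : Filter tvs_entourage.
Proof.
split; first by exists setT => //; exact: filterT.
  move=> P Q [U U0 UP] [V V0 VQ]; exists (U `&` V); first exact: filterI.
  by move=> xy [Uxy Vxy]; split; [exact: UP|exact: VQ].
by move=> P Q PQ [U U0 UP]; exists U => // xy /UP/PQ.
Qed.

Lemma tvs_entourage_refl A : tvs_entourage A -> diagonal `<=` A.
Proof.
move=> [U U0 UA] xy xyE; apply: UA; rewrite xyE subrr.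
exact: nbhs_singleton.
Qed.

Lemma tvs_entourage_inv A : tvs_entourage A -> tvs_entourage (A^-1)%relation.
Proof.
move=> [U U0 UA]; exists [set x | U (- x)].
  have := @subl_cvg 0 0 U; rewrite subrr => /(_ U0).
  by apply: filterS => t; rewrite sub0r.
by move=> [x y] /= Uxy; apply: UA; rewrite /= -opprB.
Qed.

Lemma tvs_entourage_split A : tvs_entourage A ->
  exists2 B, tvs_entourage B & (B \; B `<=` A)%relation.
Proof.
move=> [U U0 UA]; have := @sub_cvg 0 0 U; rewrite subrr => /(_ U0).
move=> [[P Q] [/= P0 Q0] PQ].
(* Two conditions are imposed so that [x - y = (x - z) - (y - z)] has its first term in [P] and its
   second in [Q]. *)
exists [set xy | P (xy.1 - xy.2) /\ Q (xy.2 - xy.1)].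
  exists (P `&` [set x | Q (- x)]).
    apply: filterI => //; have := @subl_cvg 0 0 Q; rewrite subrr => /(_ Q0).
    by apply: filterS => t; rewrite sub0r.
  by move=> [x y] /= [Pxy]; rewrite opprB.
move=> [x y] [z /= [Pxz _] [_ Qyz]]; apply: UA => /=.
by have := PQ (x - z, y - z) (conj Pxz Qyz); rewrite /= opprB addrA subrK.
Qed.

Lemma tvs_nbhsE : @nbhs E E = nbhs_ tvs_entourage.
Proof.
apply/funext => x; apply/funext => U; apply/propext; split=> [Ux|].
  exists [set xy | U (x - (xy.1 - xy.2))].
    by exists [set v | U (x - v)] => //; apply: subl_cvg; rewrite subr0.
  by move=> y /xsectionP /=; rewrite opprB addrCA subrr addr0.
move=> [A [V V0 VA] AU]; have := @subl_cvg x x V; rewrite subrr => /(_ V0).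
by apply: filterS => y Vxy; apply/AU/xsectionP/VA.
Qed.

(** A copy of [E] with the same topology, to carry the uniform structure without adding instances to
    [E]. *)
Definition tvs_uniform : Type := E.

HB.instance Definition _ := Topological.copy tvs_uniform E.
HB.instance Definition _ := @Nbhs_isUniform_mixin.Build tvs_uniform
  tvs_entourage tvs_entourage_filter tvs_entourage_refl tvs_entourage_inv
  tvs_entourage_split tvs_nbhsE.

Lemma tvs_functionally_hausdorff (x y : E) : hausdorff_space E -> x <> y ->
  exists g : E -> R, [/\ continuous g, g x = 0 & g y = 1].
Proof.
move=> hE xy.
have cy : closed [set y] by apply: accessible_closed_set1; exact: hausdorff_accessible.
have := @uniform_completely_regular R tvs_uniform x [set y] cy xy.
move=> /(@uniform_separatorP _ R)[g [cg _ g0 g1]]; exists g; split => //.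
  by apply: g0; exists x.
by apply: g1; exists y.
Qed.

End UniformStructure.

(** * Ridge functions *)

(** The preimage of a subspace under multiplication by [w]; it lets closure under products be proved
    on generators, one factor at a time. *)
Lemma lin_closed_mul {R : realType} {T : Type} (A : set (T -> R)) (w : T -> R) :
  lin_closed A -> lin_closed [set v | A (fun x => w x * v x)].
Proof.
move=> linA; split=> [|a u v Au Av] /=.
  by have := linA.1; congr A; apply: funext => x; rewrite mulr0.
have := linA.2 a _ _ Au Av; congr A; apply: funext => x.
by rewrite !fctE /GRing.scale/= mulrDr mulrCA.
Qed.

Lemma continuous_lin_closed {R : realType} {T : topologicalType} :
  lin_closed [set s : T -> R | continuous s].
Proof.
split; first by move=> x; exact: cvg_cst.
move=> a u v cu cv x; apply: cvgD; last exact: cv.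
by apply: cvgM; [exact: cvg_cst|exact: cu].
Qed.

Section RidgeFunctions.
Context {R : realType} {E : topologicalLmodType R}.
Variables (F : set (E -> R)) (phi : R -> R).
Hypothesis F_dual : F `<=` topological_dual E.
Hypothesis F_subspace : linear_subspace F.
Hypothesis phi_continuous : continuous phi.

Let S := linear_span (ridge_functions F phi).
Let linS : lin_closed S := linear_span_lin_closed _.
Let linF : lin_closed F := (linear_subspaceP F).1 F_subspace.

Let F_continuous f : F f -> continuous f. Proof. by move=> /F_dual[]. Qed.

Let FZ f (a : R) x : F f -> f (a *: x) = a * f x.
Proof.
move=> /F_dual[fl _]; have f0 : f 0 = 0.
  by have := fl (-1) 0 0; rewrite scaler0 addr0 mulN1r addNr.
by have := fl a x 0; rewrite f0 !addr0.
Qed.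

Let ridgeE (f : E -> R) (r : R) : phi \o (f + r *: cst 1) = (fun x => phi (f x + r)).
Proof. by apply: funext => x; rewrite /= !fctE /GRing.scale/= mulr1. Qed.

Lemma span_ridge_continuous s : S s -> continuous s.
Proof.
apply: (@linear_span_min _ _ _ [set s : E -> R | continuous s]).
  exact: continuous_lin_closed.
move=> _ [f [r [Ff ->]]] x; rewrite ridgeE.
apply: (@continuous_comp _ _ _ (fun x => f x + r)); last exact: phi_continuous.
by apply: cvgD; [exact: F_continuous|exact: cvg_cst].
Qed.

Lemma ridge_dense : separates_points F -> ~ is_polynomial phi ->
  forall g, continuous g -> compact_approx S g.
Proof.
move=> sepF nphi g cg.
pose V := [set v : R -> R | forall f (r : R), F f -> compact_approx S (fun x => v (f x + r))].
have linV : lin_closed V.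
  split=> [|a u v Vu Vv] f r Ff; first exact/sub_approx/linS.1.
  exact: (approx_lin_closed linS).2 (Vu f r Ff) (Vv f r Ff).
have approxV : compact_approx V `<=` V.
  move=> v Vv f r Ff; apply: (@approx_comp _ _ _ V S (fun x => f x + r) v) Vv.
    by move=> x; apply: cvgD; [exact: F_continuous|exact: cvg_cst].
  by move=> s; exact.
(* Composing with an affine map replaces [f + r] by [a f + (a r + b)], and [a f] stays in [F]. *)
have affV v (a b : R) : V v -> V (fun t => v (a * t + b)).
  move=> Vv f r Ff; have := Vv (a *: f) (a * r + b) (lin_closedZ a linF Ff).
  by congr (compact_approx _ _); apply: funext => x; rewrite mulrDr addrA.
have Vphi : V phi.
  move=> f r Ff; apply/sub_approx/sub_linear_span; by exists f, r; rewrite ridgeE.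
have Vexp := expR_closed linV approxV affV phi_continuous Vphi nphi.
(* As [exp f * exp h = exp (f + h)], this span is closed under products. *)
pose A := linear_span [set expR \o f | f in F].
have linA : lin_closed A := linear_span_lin_closed _.
have AE f : F f -> A (expR \o f) by move=> Ff; apply: sub_linear_span; exists f.
have mulA_gen f v : F f -> A v -> A (fun x => expR (f x) * v x).
  move=> Ff; apply: (@linear_span_min _ _ _ [set v | A (fun x => expR (f x) * v x)]).
    exact: lin_closed_mul.
  move=> _ [h Fh <-]; have := AE _ (lin_closedD linF Ff Fh); congr A.
  by apply: funext => x /=; rewrite expRD.
suff : compact_approx A g.
  apply: approxS; apply: linear_span_min; first exact: approx_lin_closed.
  move=> _ [f Ff <-]; have := Vexp f 0 Ff; congr (compact_approx _ _).
  by apply: funext => x; rewrite addr0.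
apply: stone_weierstrass cg => //.
- move=> u v Au; apply: (@linear_span_min _ _ _ [set v | A (fun x => u x * v x)]).
    exact: lin_closed_mul.
  move=> _ [f Ff <-]; rewrite /= (_ : (fun _ => _) = fun x => expR (f x) * u x).
    exact: mulA_gen.
  by apply: funext => x; rewrite mulrC.
- have := AE _ linF.1; congr A; apply: funext => x /=; exact: expR0.
- apply: (@linear_span_min _ _ _ [set s : E -> R | continuous s]).
    exact: continuous_lin_closed.
  move=> _ [f Ff <-] x; apply: continuous_comp; first exact: F_continuous.
  exact: continuous_expR.
- move=> x y /sepF[f Ff fxy]; exists (expR \o f); first exact: AE.
  by move=> /expR_inj.
Qed.

(** A coincidence [f x = f y] valid on all of [F] passes to the span, whereas a continuous function
    with values 0 and 1 at these points has no approximant of that kind within [1/2] on the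
    two-point compact set. *)
Lemma dense_separates : hausdorff_space E ->
  (forall g, continuous g -> compact_approx S g) -> separates_points F.
Proof.
move=> hE dS x y xy; apply: contrapT => nF.
have Fxy f : F f -> f x = f y by move=> Ff; apply: contrapT => fxy; apply: nF; exists f.
have [g [cg gx gy]] := tvs_functionally_hausdorff hE xy.
have [||s Ss gs] := dS g cg ([set x] `|` [set y]) 2^-1.
- by apply: compactU; exact: compact_set1.
- by rewrite invr_gt0.
have sxy : s x = s y.
  move: s Ss {gs}; apply: (@linear_span_min _ _ _ [set s : E -> R | s x = s y]).
    by split=> // a u v /= ux vx; rewrite !fctE ux vx.
  by move=> _ [f [r [Ff ->]]] ; rewrite ridgeE /= Fxy.
have := ltrD (gs y (or_intror erefl)) (gs x (or_introl erefl)).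
rewrite gx gy sxy; apply/negP; rewrite -leNgt (le_trans _ (ler_normB _ _))//.
by rewrite opprB addrA subrK subr0 normr1 [leRHS]splitr !mul1r.
Qed.

(* On a line [R x], the span consists of polynomials of bounded degree, all
   annihilated by one finite difference; a tent function is not. *)
Lemma dense_not_polynomial : (exists x : E, x <> 0) -> separates_points F ->
  (forall g, continuous g -> compact_approx S g) -> ~ is_polynomial phi.
Proof.
move=> [x x0] sepF dS [p phip].
have [f Ff] := sepF _ _ x0.
have f0 : f 0 = 0 by rewrite -(scale0r 0) FZ// mul0r.
rewrite f0 => /eqP fx0.
pose Delta (s : E -> R) := iter (size p) ndiff (fun j => s (j%:R *: x)) 0%N.
have DeltaS s : S s -> Delta s = 0.
  apply: (@linear_span_min _ _ _ [set s | Delta s = 0]).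
    split=> [|a u v /= Du Dv].
      rewrite /= /Delta; elim: (size p) 0%N => [//|k IH] j.
      by rewrite iterS /ndiff !IH subrr.
    have <- : a * Delta u + Delta v = 0 by rewrite Du Dv mulr0 addr0.
    exact: iter_ndiff_lin.
  move=> _ [h [r [Fh ->]]]; rewrite ridgeE /= /Delta -[RHS](iter_ndiff_poly p (h x) r).
  congr (iter _ _ _ _); apply: funext => j.
  by rewrite phip FZ// mulrC.
(* Division by [f x] puts the grid points [j x] at the integers, where the tent is 1 at 0 and 0
   afterwards. *)
pose g y : R := Num.max 0 (1 - `|f y / f x|).
have cg : continuous g.
  move=> y; apply: (@continuous_max R E (cst 0) (fun y => 1 - `|f y / f x|)); first exact: cvg_cst.
  apply: cvgB; first exact: cvg_cst.
  by apply: cvg_norm; apply: cvgM; [exact: F_continuous|exact: cvg_cst].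
have gE j : g (j%:R *: x) = (j == 0%N)%:R.
  rewrite /g FZ// mulfK// ger0_norm//; case: j => [|j]; first by rewrite subr0; apply/max_idPr.
  by apply/max_idPl; rewrite subr_le0 ler1n.
(* Each difference at most doubles the error, so [Delta (g - s)] is at most [1/2] in absolute value,
   whereas it equals a power of -1. *)
pose e : R := 2^-1 / 2 ^+ size p.
have e0 : 0 < e by rewrite divr_gt0 ?invr_gt0 ?exprn_gt0.
have [|s Ss gs] := dS g cg [set j%:R *: x | j in `I_(size p).+1] e _ e0.
  by apply: finite_compact; apply: finite_image; exact: finite_II.
have : `|Delta (g - s)| <= 2^-1.
  have -> : 2^-1 = 2 ^+ size p * e by rewrite /e mulrCA mulfV ?mulr1// expf_neq0.
  apply: iter_ndiff_bound => j jp; apply/ltW/gs; exists j => //=.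
have -> : Delta (g - s) = (-1) ^+ size p.
  have <- : -1 * Delta s + Delta g = (-1) ^+ size p.
    by rewrite DeltaS// mulr0 add0r; exact: iter_ndiff_delta.
  rewrite -iter_ndiff_lin; congr (iter _ _ _ _); apply: funext => j.
  by rewrite !fctE mulN1r addrC.
by rewrite normrX normrN1 expr1n; lra.
Qed.

End RidgeFunctions.

Theorem theorem2p4 (R : realType) (E : topologicalLmodType R)
    (E_nontrivial : exists x : E, x <> 0)
    (E_hausdorff : hausdorff_space E)
    (F : set (E -> R))
    (F_dual : F `<=` topological_dual E)
    (F_subspace : linear_subspace F)
    (phi : R -> R) (phi_continuous : continuous phi) :
  dense [set g : continuousType E R |
           linear_span (ridge_functions F phi) (g : E -> R)] <->
  separates_points F /\ ~ is_polynomial phi.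
Proof.
have cS := span_ridge_continuous F_dual phi_continuous.
split=> [/(dense_approxP cS) dS|[sepF nphi]].
  have sepF := dense_separates E_hausdorff dS.
  by split=> //; exact: (dense_not_polynomial F_dual E_nontrivial sepF dS).
by apply/(dense_approxP cS); exact: ridge_dense.
Qed.
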